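(* Let $\varepsilon>0$ be fixed and let $p=p(n)$ satisfy $n^{-1/2+\varepsilon}\le p\le 1-\varepsilon$. Let $G\in G(n,p)$. Then asymptotically almost surely $$\mathcal{AC}(G)\ \ge\ \overline{\mathcal{AC}}(G)\ \ge\ \frac{\varepsilon}{2}\log_{1/(1-p)} n,$$ and in particular $\overline{\mathcal{AC}}(G)=\Omega(\log n/p)$ a.a.s.
   Context: $G(n,p)$ denotes the binomial random graph on vertex set $\{1,\dots,n\}$ in which each pair is an edge independently with probability $p$. Acquaintance time: for a finite connected graph $G$, one agent is initially placed on each vertex; two agents become (permanently) acquainted whenever they occupy adjacent vertices at some point (including at the start). In each round one chooses a matching of $G$ and swaps the agents at the endpoints of each matching edge. $\mathcal{AC}(G)$ is the minimum number of rounds until all pairs of agents are acquainted (for disconnected $G$ one may take $\mathcal{AC}(G)=\infty$). Helicopter variant: for any graph $G$ (not necessarily connected), one agent starts on each vertex, and in each round the agents may be moved according to an arbitrary permutation $\pi$ of $V(G)$ (the agent on $v$ moves to $\pi(v)$), with acquaintance defined as before; $\overline{\mathcal{AC}}(G)$ is the minimum number of rounds until all pairs of agents are acquainted. Equivalently, $\overline{\mathcal{AC}}(G)+1$ is the minimum number of copies of $G$ (on the same vertex set, relabelled) needed to cover all edges of $K_n$. ''Asymptotically almost surely'' means with probability tending to $1$ as $n\to\infty$. *)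

(* Defs.v *)
From HB Require Import structures.
From mathcomp Require Import all_boot all_order all_algebra all_fingroup.
From mathcomp Require Import all_classical all_reals all_analysis.

Set Implicit Arguments.
Unset Strict Implicit.
Unset Printing Implicit Defensive.

Import Order.TTheory GRing.Theory Num.Theory.
Import numFieldNormedType.Exports.

Local Open Scope classical_set_scope.
Local Open Scope ring_scope.

Record sgraph (T : finType) := SGraph {
  edges : {set {set T}};
  edges_card2 : [forall e in edges, #|e| == 2%N]
}.

HB.instance Definition _ (T : finType) := [isSub for @edges T].
HB.instance Definition _ (T : finType) := [Countable of sgraph T by <:].
HB.instance Definition _ (T : finType) := [Finite of sgraph T by <:].

Definition adj (T : finType) (G : sgraph T) : rel T :=
  fun u v => [set u; v]%SET \in edges G.

Definition matching (T : finType) (G : sgraph T) (M : {set {set T}}) : Prop :=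
  (M \subset edges G) /\ finset.trivIset M.

(* As [[set u; v]] is unordered, the first clause also gives [s v = u]. *)
Definition swaps_along (T : finType) (M : {set {set T}}) (s : {perm T}) : Prop :=
  (forall u v : T, [set u; v]%SET \in M -> s u = v) /\
  (forall v : T, v \notin finset.cover M -> s v = v).

(* Agents are named by their initial vertices.  In [{perm T}] a product applies
   its left factor first, so this is the vertex occupied by agent [a] after the
   first [k] of the rounds [ss]. *)
Definition position (T : finType) (ss : seq {perm T}) (k : nat) (a : T) : T :=
  (\prod_(s <- take k ss) s)%g a.

(* [legal] is the set of moves available in a round; [k = 0] is the initial
   placement. *)
Definition acquainted_in (T : finType) (G : sgraph T) (legal : set {perm T})
    (t : nat) : Prop :=
  exists ss : seq {perm T},
    [/\ size ss = t,
        forall s, s \in ss -> legal s &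
        forall a b : T, a != b ->
          exists2 k : nat, (k <= t)%N &
            adj G (position ss k a) (position ss k b)].

(* Least number of rounds; [+oo] when no strategy acquaints all pairs, since
   then the infimum is over the empty set. *)
Definition min_rounds (R : realType) (T : finType) (G : sgraph T)
    (legal : set {perm T}) : \bar R :=
  ereal_inf [set (t%:R)%:E | t in [set t : nat | acquainted_in G legal t]].

Definition acquaintance_time (R : realType) (T : finType) (G : sgraph T) : \bar R :=
  min_rounds R G [set s | exists2 M, matching G M & swaps_along M s].

Definition helicopter_time (R : realType) (T : finType) (G : sgraph T) : \bar R :=
  min_rounds R G [set: {perm T}].

Definition gnp_weight (R : realType) (n : nat) (p : R) (G : sgraph 'I_n) : R :=
  \prod_(e : {set 'I_n} | #|e| == 2%N) (if e \in edges G then p else 1 - p).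

Definition gnp_prob (R : realType) (n : nat) (p : R) (A : set (sgraph 'I_n)) : R :=
  \sum_(G : sgraph 'I_n | `[< A G >]) gnp_weight p G.

Definition aas (R : realType) (p : nat -> R)
    (A : forall n : nat, set (sgraph 'I_n)) : Prop :=
  (fun n : nat => gnp_prob (p n) (A n)) @ \oo --> (1 : R).

Definition log_base (R : realType) (b x : R) : R := ln x / ln b.

(* Main.v *)
Require Import Defs.
From mathcomp Require Import all_boot all_order all_algebra all_fingroup.
From mathcomp Require Import all_classical all_reals all_analysis.
From mathcomp Require Import ring lra zify.

Import Order.TTheory GRing.Theory Num.Theory.
Import numFieldNormedType.Exports.

Local Open Scope classical_set_scope.
Local Open Scope ring_scope.

(** The helicopter time is less than [L] only if [d = truncn L + 1] permuted
    copies of [G] cover all pairs of agents.  For fixed permutations this says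
    that [G] hits ['C(n, 2)] sets of at most [d] potential edges, each edge being
    in at most [d] of them.  Revealing these sets edge by edge, and stopping in
    each at its first present edge, one can process [N = 'C(n, 2) / d] sets
    without ever having to reuse a present edge, so all sets are hit with
    probability at most [(1 - q^d)^N], where [q = 1 - p].  Choosing [N] sets that
    are actually disjoint would cost a factor [d^2] instead of [d], which is not
    affordable for [p] near [n^(-1/2)].  As [q^d >= eps * n^(-eps/2)] and
    [d = O(n^(1/2 - eps) log n)], this beats the [n!^d] choices of permutations. *)

(** * Random subsets with independent elements *)

Definition subset_prob (R : realType) (T : finType) (p : R) (D : {set T})
    (P : pred {set T}) : R :=
  \sum_(W : {set T} | (W \subset D) && P W)
    \prod_(e in D) (if e \in W then p else 1 - p).

Arguments subset_prob {R T} p D P.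

Section SubsetProb.
Variables (R : realType) (T : finType) (p : R).
Implicit Types (D W : {set T}) (P Q : pred {set T}).

(** Conditioning on whether [f] is present; this reveals one element at a time, with [D] the part
    still unrevealed. *)
Lemma subset_prob_split D P f : f \in D ->
  subset_prob p D P =
    p * subset_prob p (D :\ f)%SET (fun W => P (f |: W)%SET) +
    (1 - p) * subset_prob p (D :\ f)%SET P.
Proof.
move=> fD; rewrite /subset_prob (bigID (fun W : {set T} => f \in W)) /=.
congr (_ + _); rewrite big_distrr /=.
- rewrite (reindex_onto (fun W : {set T} => f |: W)%SET
    (fun W : {set T} => W :\ f)%SET) /=; last first.
    by move=> W /andP[_ fW]; rewrite finset.setD1K.
  apply: eq_big => [W|W /andP[/andP[/andP[WD _] _] /eqP fW]].
    rewrite finset.setU11 andbT finset.subUset finset.sub1set fD /= finset.subsetD1.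
    rewrite -!andbA; congr (_ && _); rewrite andbC; congr (_ && _).
    apply/eqP/idP => [<-|fW]; first by rewrite finset.setD11.
    by rewrite finset.setU1K.
  rewrite (finset.big_setD1 f) //= finset.setU11; congr (_ * _).
  apply: eq_bigr => e; rewrite !inE => /andP[/negbTE ef _].
  by rewrite ef.
apply: eq_big => [W|W /andP[/andP[WD _] /negbTE fW]].
  by rewrite finset.subsetD1 -!andbA; congr (_ && _); rewrite andbC.
by rewrite (finset.big_setD1 f) //= fW.
Qed.

Lemma subset_prob_predT D : subset_prob p D xpredT = 1.
Proof.
elim: {D}_.+1 {-2}D (ltnSn #|D|) => // m IH D.
have [->|[f fD]] := finset.set_0Vmem D.
  move=> _; rewrite /subset_prob (big_pred1 finset.set0) ?finset.big_set0 // => W.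
  by rewrite andbT finset.subset0.
rewrite (finset.cardsD1 f) fD add1n !ltnS => Dm.
by rewrite (subset_prob_split _ _ _ fD) !IH // -mulrDl subrKC mul1r.
Qed.

Hypotheses (p_ge0 : 0 <= p) (p_le1 : p <= 1).

Lemma subset_weight_ge0 D W : 0 <= \prod_(e in D) (if e \in W then p else 1 - p).
Proof. by apply: prodr_ge0 => e _; case: ifP => _ //; rewrite subr_ge0. Qed.

Lemma le_subset_prob D P Q :
  (forall W, W \subset D -> P W -> Q W) -> subset_prob p D P <= subset_prob p D Q.
Proof.
move=> PQ; rewrite /subset_prob big_mkcond [leRHS]big_mkcond /=.
apply: ler_sum => W _; case: (boolP (W \subset D)) => //= WD.
case: (boolP (P W)) => [/(PQ _ WD) -> //|_].
by case: ifP => // _; exact: subset_weight_ge0.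
Qed.

Lemma subset_prob_le1 D P : subset_prob p D P <= 1.
Proof. by rewrite -(subset_prob_predT D); exact: le_subset_prob. Qed.

Lemma subset_prob_union (I : finType) D (P : I -> pred {set T}) (b : R) :
  (forall i, subset_prob p D (P i) <= b) ->
  subset_prob p D (fun W => [exists i, P i W]) <= #|I|%:R * b.
Proof.
move=> Pb; apply: (@le_trans _ _ (\sum_i subset_prob p D (P i))).
  rewrite /subset_prob; under [leRHS]eq_bigr do rewrite big_mkcond.
  rewrite exchange_big /= big_mkcond /=; apply: ler_sum => W _.
  have w0 i : 0 <= (if (W \subset D) && P i W then
      \prod_(e in D) (if e \in W then p else 1 - p) else 0).
    by case: ifP => // _; exact: subset_weight_ge0.
  case: ifP => [/andP[WD /existsP[i Pi]]|_]; last by apply: sumr_ge0.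
  rewrite (bigD1 i) //= {1}WD Pi lerDl; apply: sumr_ge0 => j _; exact: w0.
by rewrite mulr_natl -sumr_const; apply: ler_sum.
Qed.

(** * Hitting all members of a family of small sets of bounded degree *)

Section Hitting.
Variables (I : finType) (S : I -> {set T}) (d : nat).

Definition hits (J : {set I}) (W : {set T}) : bool :=
  [forall i in J, ~~ [disjoint S i & W]].

Hypothesis d_gt0 : (0 < d)%N.
Hypothesis card_S : forall i, (#|S i| <= d)%N.
Hypothesis deg_S : forall f, (#|[set i | f \in S i]%SET| <= d)%N.

(* [D] is the set of elements not yet revealed.  When an element of [S i] is
   found present, the at most [d] sets containing it are discarded, so that all
   revealed elements of the remaining sets are absent. *)
Lemma subset_prob_hits_partial N r D (J : {set I}) i :
  i \in J -> (#|S i :&: D|%SET <= r)%N -> (N * d < #|J|)%N ->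
  subset_prob p D (hits J) <= (1 - (1 - p) ^+ r) * (1 - (1 - p) ^+ d) ^+ N.
Proof.
have q0 : 0 <= 1 - p by rewrite subr_ge0.
have q1 : 1 - p <= 1 by rewrite lerBlDr lerDl.
have h0 k : 0 <= 1 - (1 - p) ^+ k by rewrite subr_ge0 exprn_ile1.
elim: {D}_.+1 {-2}D (ltnSn #|D|) N r J i => // m IH D Dm N r J i iJ Sr NJ.
(* With nothing of [S i] left to reveal, no [W] inside [D] can hit it, so the sum is empty. *)
have [SD0|[f]] := finset.set_0Vmem (S i :&: D)%SET.
  rewrite /subset_prob big_pred0 ?mulr_ge0 ?exprn_ge0 // => W.
  apply/negbTE/negP => /andP[WD /forall_inP /(_ _ iJ)].
  by rewrite -finset.setI_eq0 -finset.subset0 -SD0 finset.setIS.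
move=> fSD; move: (fSD); rewrite inE => /andP[fS fD].
have Df : (#|D :\ f|%SET < m)%N.
  by move: Dm; rewrite (finset.cardsD1 f) fD add1n ltnS.
rewrite (subset_prob_split _ _ _ fD).
case: r Sr => [|r] Sr.
  by move: Sr; rewrite leqn0 finset.cards_eq0 => /eqP SD0; rewrite SD0 inE in fSD.
have le_absent : subset_prob p (D :\ f)%SET (hits J) <=
    (1 - (1 - p) ^+ r) * (1 - (1 - p) ^+ d) ^+ N.
  apply: IH iJ _ NJ => //; move: Sr; rewrite (finset.cardsD1 f) fSD add1n ltnS.
  by rewrite finset.setIDA.
have le_present : subset_prob p (D :\ f)%SET (fun W => hits J (f |: W)%SET) <=
    (1 - (1 - p) ^+ d) ^+ N.
  pose J' := (J :\: [set i | f \in S i])%SET.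
  apply: (@le_trans _ _ (subset_prob p (D :\ f)%SET (hits J'))).
    apply: le_subset_prob => W _ /forall_inP hJ; apply/forall_inP => j.
    rewrite !inE => /andP[fj jJ]; have := hJ j jJ.
    have Sjf : (S j :&: [set f] = finset.set0)%SET.
      by apply/eqP; rewrite finset.setI_eq0 disjoint_sym disjoints1.
    by rewrite -!finset.setI_eq0 finset.setIUr Sjf finset.set0U.
  (* Lowering [N] by one pays for the at most [d] discarded sets; strictness in [NJ'] leaves a set
     [j] to process next, with full allowance [r = d]. *)
  case: N NJ {le_absent} => [|N] NJ; first by rewrite expr0 subset_prob_le1.
  have NJ' : (N * d < #|J'|)%N.
    have := finset.cardsID [set i | f \in S i]%SET J.
    have := subset_leq_card (finset.subsetIr J [set i | f \in S i]%SET).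
    have := deg_S f; move: NJ; rewrite mulSn -/J'; lia.
  have /card_gt0P[j jJ'] : (0 < #|J'|)%N by exact: leq_ltn_trans NJ'.
  rewrite exprS; apply: IH jJ' _ NJ' => //.
  exact: leq_trans (subset_leq_card (finset.subsetIl _ _)) (card_S j).
(* First-success decomposition: among [r.+1] trials the first succeeds, or it fails and one of the
   other [r] succeeds. *)
have -> : 1 - (1 - p) ^+ r.+1 = p + (1 - p) * (1 - (1 - p) ^+ r).
  by rewrite exprS; ring.
by rewrite [leRHS]mulrDl -[in leRHS]mulrA lerD // ler_wpM2l.
Qed.

(** The first set, opened with allowance [r = d], supplies one of the [N] factors; the partial bound
    supplies the remaining ones. *)
Lemma subset_prob_hits N D (J : {set I}) : (N * d <= #|J|)%N ->
  subset_prob p D (hits J) <= (1 - (1 - p) ^+ d) ^+ N.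
Proof.
case: N => [|N] NJ; first by rewrite expr0 subset_prob_le1.
have NJ' : (N * d < #|J|)%N by apply: leq_trans NJ; rewrite ltn_pmul2r.
have /card_gt0P[j jJ] : (0 < #|J|)%N by exact: leq_ltn_trans NJ'.
rewrite exprS; apply: subset_prob_hits_partial jJ _ NJ'.
exact: leq_trans (subset_leq_card (finset.subsetIl _ _)) (card_S j).
Qed.

End Hitting.
End SubsetProb.

Arguments hits {T I} S J W.

(** * The binomial random graph as a random subset of the pairs *)

Definition pairs (n : nat) : {set {set 'I_n}} :=
  [set e : {set 'I_n} | #|e| == 2%N]%SET.

Section GnpProb.
Variables (R : realType) (n : nat) (p : R).
Implicit Types A B : set (sgraph 'I_n).

Lemma edges_subset_pairs (G : sgraph 'I_n) : edges G \subset pairs n.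
Proof.
by apply/fintype.subsetP => e eG; rewrite inE; move/forall_inP: (edges_card2 G); exact.
Qed.

Lemma gnp_prob_edges (P : pred {set {set 'I_n}}) :
  gnp_prob p [set G | P (edges G)] = subset_prob p (pairs n) P.
Proof.
have E0 : [forall e in (finset.set0 : {set {set 'I_n}}), #|e| == 2%N].
  by apply/forall_inP => e; rewrite inE.
(* The empty graph is a default value, taken only when [W] is not a set of pairs. *)
pose toG (W : {set {set 'I_n}}) : sgraph 'I_n := insubd (SGraph E0) W.
rewrite /gnp_prob /subset_prob.
rewrite [RHS](reindex_onto (@edges 'I_n) toG) /=; last first.
  move=> W /andP[/fintype.subsetP WE _]; rewrite /toG insubdK //.
  by apply/forall_inP => e /WE; rewrite inE.
apply: eq_big => [G|G _].
  rewrite edges_subset_pairs /toG (valKd _ G) eqxx andbT.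
  exact/asboolP/idP.
by rewrite /gnp_weight; apply: eq_bigl => e; rewrite inE.
Qed.

Lemma gnp_probT : gnp_prob p [set: sgraph 'I_n] = 1.
Proof.
have -> : [set: sgraph 'I_n] = [set G | xpredT (edges G)] by apply/seteqP; split.
by rewrite (gnp_prob_edges xpredT) subset_prob_predT.
Qed.

Lemma gnp_prob_setC A : gnp_prob p A + gnp_prob p (~` A) = 1.
Proof.
rewrite -gnp_probT /gnp_prob [RHS](bigID (fun G => `[< A G >])) /=.
by congr (_ + _); apply: eq_bigl => G;
  rewrite (@asboolT ([set: sgraph 'I_n] G)) //= -asbool_neg.
Qed.

Hypotheses (p_ge0 : 0 <= p) (p_le1 : p <= 1).

Lemma le_gnp_prob A B : A `<=` B -> gnp_prob p A <= gnp_prob p B.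
Proof.
move=> AB; rewrite /gnp_prob big_mkcond [leRHS]big_mkcond /=.
have w0 G : 0 <= gnp_weight p G.
  by apply: prodr_ge0 => e _; case: ifP => _ //; rewrite subr_ge0.
apply: ler_sum => G _; case: (asboolP (A G)) => [/AB BG|_].
  by rewrite asboolT.
by case: ifP.
Qed.

Lemma gnp_prob_le1 A : gnp_prob p A <= 1.
Proof. by rewrite -gnp_probT; apply: le_gnp_prob. Qed.

End GnpProb.

Arguments gnp_prob_setC {R n} p A.
Arguments gnp_prob_edges {R n} p P.

(** * Helicopter strategies as families of permutations *)

Section Acquaintance.
Variables (R : realType) (T : finType) (G : sgraph T).

Lemma le_min_rounds (A B : set {perm T}) : A `<=` B ->
  (min_rounds R G B <= min_rounds R G A)%E.
Proof.
move=> AB; apply: ereal_inf_le_tmp => _ [t [ss [st legal acq]] <-].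
by exists t => //; exists ss; split => // s /legal /AB.
Qed.

Lemma helicopter_le_acquaintance :
  (helicopter_time R G <= acquaintance_time R G)%E.
Proof. exact: le_min_rounds. Qed.

End Acquaintance.

(* A pair of agents and a pair of vertices are both a 2-subset of [T]; [s k] maps
   each agent to its position after [k] rounds. *)
Definition pair_visits (T : finType) (d : nat) (s : {ffun 'I_d -> {perm T}})
    (e : {set T}) : {set {set T}} :=
  [set [set s k v | v in e] | k : 'I_d]%SET.

Arguments pair_visits {T d} s e.

Section PairVisits.
Variables (T : finType) (d : nat) (s : {ffun 'I_d -> {perm T}}).

Lemma card_pair_visits e : (#|pair_visits s e| <= d)%N.
Proof. by rewrite -[leqRHS]card_ord; exact: leq_imset_card. Qed.

(** Each index [k] accounts for at most one [e], namely the preimage of [f] under [s k]. *)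
Lemma deg_pair_visits f : (#|[set e | f \in pair_visits s e]%SET| <= d)%N.
Proof.
rewrite -[leqRHS]card_ord.
apply: leq_trans (leq_imset_card (fun k => [set (s k)^-1%g v | v in f]%SET) 'I_d).
apply: subset_leq_card; apply/fintype.subsetP => e; rewrite inE.
move=> /imsetP[k _ ->]; apply/imsetP; exists k => //.
rewrite -imset_comp -[LHS]imset_id; apply: eq_imset => v /=.
by rewrite permK.
Qed.

End PairVisits.

(** A number of rounds below [L] is at most [truncn L]; counting the initial placement,
    [truncn L + 1] permutations suffice. *)
Lemma helicopter_lt_hits (R : realType) (n : nat) (G : sgraph 'I_n) (L : R) :
  (helicopter_time R G < L%:E)%E ->
  exists s : {ffun 'I_(Num.truncn L).+1 -> {perm 'I_n}},
    hits (pair_visits s) (pairs n) (edges G).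
Proof.
move=> /ereal_inf_lt[_ [t [ss [st _ acq]] <-]]; rewrite lte_fin => tL.
have tK : (t <= Num.truncn L)%N by rewrite truncn_ge_nat ltW // (le_lt_trans _ tL).
(* Beyond the length of [ss], [take k ss] is all of [ss]: a shorter strategy is padded by repeating
   its final placement. *)
exists [ffun k : 'I_(Num.truncn L).+1 => (\prod_(r <- take k ss) r)%g].
apply/forall_inP => e; rewrite inE => /cards2P[a [b [ab ->]]].
have [k kt adjk] := acq a b ab.
apply/pred0Pn; exists [set position ss k a; position ss k b]%SET.
apply/andP; split => //=; apply/imsetP.
have kK : (k < (Num.truncn L).+1)%N by exact: leq_trans kt tK.
exists (Ordinal kK) => //.
by rewrite finset.imsetU !finset.imset_set1 ffunE.
Qed.

Lemma gnp_prob_helicopter_ge (R : realType) (n N : nat) (p L : R) :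
  0 <= p -> p <= 1 -> (N * (Num.truncn L).+1 <= 'C(n, 2))%N ->
  1 - (n`! ^ (Num.truncn L).+1)%:R * (1 - (1 - p) ^+ (Num.truncn L).+1) ^+ N <=
  gnp_prob p [set G : sgraph 'I_n | (L%:E <= helicopter_time R G)%E].
Proof.
move=> p0 p1; set d := (Num.truncn L).+1 => NC.
set A : set (sgraph 'I_n) := [set G | _].
rewrite lerBlDr -[leLHS](gnp_prob_setC p A) lerD2l.
pose bad (s : {ffun 'I_d -> {perm 'I_n}}) := hits (pair_visits s) (pairs n).
apply: (@le_trans _ _
    (gnp_prob p [set G : sgraph 'I_n | [exists s, bad s (edges G)]])).
  apply: le_gnp_prob => // G /= /negP; rewrite -ltNge => /helicopter_lt_hits[s hs].
  by apply/existsP; exists s.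
rewrite (gnp_prob_edges p (fun W => [exists s, bad s W])).
have -> : (n`! ^ d)%N = #|{ffun 'I_d -> {perm 'I_n}}|.
  by rewrite card_ffun card_ord -card_Sn; congr (_ ^ _)%N; apply: eq_card => x.
apply: subset_prob_union => // s; apply: subset_prob_hits => //.
- exact: card_pair_visits.
- exact: deg_pair_visits.
- by rewrite /pairs card_draws card_ord.
Qed.

(** * Growth estimates *)

Section Asymptotics.
Variable R : realType.
Implicit Types eps x q p : R.

(** With [y = eps / 4] the exponent is [6 * y * x]. One half dominates [(y * (1 + x)) ^+ 3], the
    other half the constant [16 / eps * y ^- 3]. *)
Lemma cube_le_expR eps : 0 < eps -> eps <= 1 ->
  exists X : R, forall x, X <= x ->
    16 * (1 + x) ^+ 3 <= eps * expR (3 / 2 * eps * x).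
Proof.
move=> e0 e1.
have ye0 : 0 < eps / 4 by rewrite divr_gt0.
have ye1 : eps / 4 <= 1 by lra.
(* Chosen so that [3 * y * x] already exceeds the constant, whence so does its exponential. *)
exists (16 / eps * (eps / 4) ^- 3 / (3 * (eps / 4))) => x.
set y := eps / 4 in ye0 ye1 *.
rewrite ler_pdivrMr ?mulr_gt0 // => xX.
have x0 : 0 <= x.
  have : 0 <= 16 / eps * y ^- 3 by rewrite mulr_ge0 ?invr_ge0 ?exprn_ge0 ?divr_ge0 // ltW.
  by move=> /le_trans/(_ xX); rewrite pmulr_lge0 ?mulr_gt0.
have yx : y * (1 + x) <= expR (y * x).
  by apply: le_trans (expR_ge1Dx _); rewrite mulrDr mulr1 lerD2r.
have y3x : (y * (1 + x)) ^+ 3 <= expR (y * x) ^+ 3.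
  by rewrite lerXn2r // ?nnegrE ?expR_ge0 // mulr_ge0 ?ltW //; lra.
have -> : 3 / 2 * eps * x = 3%:R * (y * x) + 3%:R * (y * x) by rewrite /y; field.
rewrite expRD expRM_natl.
have Xx : 16 / eps * y ^- 3 <= expR (y * x) ^+ 3.
  rewrite -expRM_natl; apply: le_trans xX _; apply: le_trans (expR_ge1Dx _).
  rewrite [X in _ <= X](_ : _ = 1 + x * (3 * y)); last by ring.
  by rewrite lerDr.
have -> : 16 * (1 + x) ^+ 3 = eps * (16 / eps * y ^- 3 * (y * (1 + x)) ^+ 3).
  by field; rewrite !gt_eqF.
rewrite ler_pM2l //; apply: ler_pM => //.
- by rewrite mulr_ge0 ?invr_ge0 ?exprn_ge0 ?divr_ge0 // ltW.
- by rewrite exprn_ge0 // mulr_ge0 ?ltW //; lra.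
Qed.

Lemma le_ln_inv_compl p : p < 1 -> p <= ln (1 / (1 - p)).
Proof.
move=> p1; rewrite div1r lnV ?posrE ?subr_gt0 // lerNr.
by apply: le_ln1Dx; rewrite ltrN2.
Qed.

Lemma ln_inv_compl_le p eps : 0 < eps -> 0 <= p -> p <= 1 - eps ->
  ln (1 / (1 - p)) <= p / eps.
Proof.
move=> e0 p0 pe.
have q0 : 0 < 1 - p by lra.
have -> : 1 / (1 - p) = 1 + p / (1 - p) by field; rewrite gt_eqF.
have pq0 : 0 <= p / (1 - p) by rewrite divr_ge0 // ltW.
apply: (@le_trans _ _ (p / (1 - p))); first by apply: le_ln1Dx; lra.
by rewrite ler_wpM2l // lef_pV2 ?posrE //; lra.
Qed.

Lemma fact_leq_expn n : (n`! <= n ^ n)%N.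
Proof.
elim: n => // n IH; rewrite factS expnS leq_pmul2l //.
apply: leq_trans IH _.
by case: n => // n; rewrite leq_exp2r.
Qed.

Lemma fact_expn_le_expR (n d : nat) : (0 < n)%N ->
  (n`! ^ d)%:R <= expR (d%:R * n%:R * ln n%:R) :> R.
Proof.
move=> n0; rewrite -natrM expRM_natl lnK ?posrE ?ltr0n // -natrX ler_nat mulnC expnM.
by case: d => // d; rewrite leq_exp2r // fact_leq_expn.
Qed.

Lemma union_bound_le (n d : nat) eps q : (1 < n)%N -> (0 < d)%N -> 1 <= ln (n%:R : R) ->
  0 < eps -> eps <= 1 -> 0 <= q -> q <= 1 ->
  d%:R <= expR ((1 / 2 - eps) * ln n%:R) * (1 + ln n%:R) ->
  eps * expR (- (eps / 2 * ln n%:R)) <= q ^+ d ->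
  16 * (1 + ln n%:R) ^+ 3 <= eps * expR (3 / 2 * eps * ln n%:R) ->
  (n`! ^ d)%:R * (1 - q ^+ d) ^+ ('C(n, 2) %/ d) <= n%:R^-1.
Proof.
move=> n1 d0 x1 e0 e1 q0 q1 dle qle cube.
set x := ln n%:R in x1 dle qle cube *; set N := ('C(n, 2) %/ d)%N.
have n0 : (0 < n)%N := ltnW n1.
have nE : n%:R = expR x by rewrite lnK // posrE ltr0n.
set E := expR (- (eps / 2 * x)) in qle.
set y : R := n%:R in nE *; set D : R := d%:R in dle *.
have y2 : 2 <= y by rewrite /y ler_nat.
have D1 : 1 <= D by rewrite /D ler1n.
have E0 : 0 < E := expR_gt0 _.
have E1 : E <= 1 by rewrite expR_le1 oppr_le0 !mulr_ge0 //; lra.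
have x0 : 0 < x by lra.
have yx1 : 1 <= y * x by rewrite -[1]mulr1 ler_pM //; lra.
(* [d^2 n ln n] is small against [n^(2 - eps/2)]. *)
have D2yx : 16 * (D ^+ 2 * (y * x)) <= eps * y ^+ 2 * E.
  have D2 : D ^+ 2 <= expR ((1 - 2 * eps) * x) * (1 + x) ^+ 2.
    have -> : expR ((1 - 2 * eps) * x) = expR ((1 / 2 - eps) * x) ^+ 2.
      by rewrite -expRM_natl; congr expR; field.
    by rewrite -exprMn lerXn2r // nnegrE ?mulr_ge0 ?expR_ge0 //; lra.
  apply: (@le_trans _ _ (expR ((1 - 2 * eps) * x) * y * (16 * (1 + x) ^+ 3))).
    have -> : expR ((1 - 2 * eps) * x) * y * (16 * (1 + x) ^+ 3) =
        16 * (expR ((1 - 2 * eps) * x) * (1 + x) ^+ 2 * (y * (1 + x))) by ring.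
    have yx : y * x <= y * (1 + x) by rewrite ler_wpM2l //; lra.
    by rewrite ler_pM2l // ler_pM ?exprn_ge0 //; lra.
  have -> : eps * y ^+ 2 * E =
      expR ((1 - 2 * eps) * x) * y * (eps * expR (3 / 2 * eps * x)).
    have -> : eps * y ^+ 2 * E = eps * y * (y * E) by ring.
    (* Origin of [3 / 2]: [1 - eps / 2 = (1 - 2 * eps) + 3 / 2 * eps]. *)
    have -> : y * E = expR ((1 - 2 * eps) * x) * expR (3 / 2 * eps * x).
      by rewrite nE /E -!expRD; congr expR; field.
    by ring.
  by rewrite ler_pM2l // mulr_gt0 ?expR_gt0 //; lra.
(* Makes the remainder in the division of ['C(n, 2)] by [d] negligible. *)
have D_small : 16 * D <= y ^+ 2.
  apply: (@le_trans _ _ (16 * (D ^+ 2 * (y * x)))).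
    by rewrite ler_pM2l // -[leLHS]mulr1 ler_pM //; nra.
  apply: le_trans D2yx _; rewrite mulrAC ler_piMl ?exprn_ge0 //.
  by rewrite mulr_ile1 // ltW.
have C_large : y ^+ 2 <= 4 * ('C(n, 2))%:R.
  have : (n * n.-1 = 2 * 'C(n, 2))%N by rewrite -mul_bin_diag bin1.
  move=> /(congr1 (fun k => k%:R : R)); rewrite !natrM -subn1 natrB // -/y; nra.
have DN : y ^+ 2 <= 8 * (D * N%:R).
  have : ('C(n, 2) <= d * N + d)%N.
    by rewrite [leqLHS](divn_eq _ d) mulnC leq_add2l ltnW // ltn_mod.
  by rewrite -(ler_nat R) natrD natrM -/D; nra.
have Nq : 2 * (D * y * x) <= N%:R * q ^+ d.
  rewrite -(ler_pM2l (_ : 0 < D)); last by lra.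
  apply: (@le_trans _ _ (y ^+ 2 / 8 * (eps * E))); first by nra.
  rewrite [leRHS]mulrA ler_pM //; last by lra.
    by rewrite divr_ge0 ?exprn_ge0 //; lra.
  by rewrite mulr_ge0 // ltW.
have qd1 : q ^+ d <= 1 by rewrite exprn_ile1.
apply: (@le_trans _ _ (expR (D * y * x) * expR (- (N%:R * q ^+ d)))).
  apply: ler_pM => //; first by rewrite exprn_ge0 // subr_ge0.
    exact: fact_expn_le_expR.
  rewrite -mulrN expRM_natl lerXn2r ?nnegrE ?subr_ge0 ?expR_ge0 //.
  exact: expR_ge1Dx.
rewrite -expRD [in leRHS]nE -expRN ler_expR.
have : x <= D * y * x by rewrite -[leLHS]mul1r ler_wpM2r //; nra.
lra.
Qed.

End Asymptotics.

(** * The logarithmic lower bound and its consequences *)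

Lemma gnp_prob_helicopter_log_ge (R : realType) (n : nat) (eps p : R) :
  (1 < n)%N -> 1 <= ln (n%:R : R) -> 0 < eps ->
  16 * (1 + ln n%:R) ^+ 3 <= eps * expR (3 / 2 * eps * ln n%:R) ->
  n%:R `^ (- (1 / 2) + eps) <= p -> p <= 1 - eps ->
  1 - n%:R^-1 <= gnp_prob p [set G : sgraph 'I_n |
    ((eps / 2 * log_base (1 / (1 - p)) n%:R)%:E <= helicopter_time R G)%E].
Proof.
move=> n1 x1 e0 cube pn pe.
have n0 : n%:R != 0 :> R by rewrite pnatr_eq0 -lt0n ltnW.
have p0 : 0 < p by apply: lt_le_trans pn; rewrite powR_gt0 // lt_neqAle eq_sym n0 /=.
have p1 : p < 1 by lra.
have e1 : eps <= 1 by lra.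
move: pn; rewrite /powR (negbTE n0); set x := ln n%:R in x1 cube * => pn.
(* Otherwise [p] would be at least 1. This makes [M >= 1] below, which absorbs the rounding up in
   [d]. *)
have e12 : eps <= 1 / 2.
  rewrite leNgt; apply/negP => e12.
  have : 1 <= expR ((- (1 / 2) + eps) * x).
    by rewrite -[leLHS]expR0 ler_expR mulr_ge0 //; lra.
  lra.
rewrite /log_base -/x; set l := ln (1 / (1 - p)).
have pl : p <= l by exact: le_ln_inv_compl.
have l0 : 0 < l by lra.
set L := eps / 2 * (x / l).
have L0 : 0 <= L by rewrite !mulr_ge0 ?invr_ge0 //; lra.
have KL : (Num.truncn L)%:R <= L by rewrite truncn_le.
have q0 : 0 < 1 - p by lra.
have q1 : 1 - p <= 1 by lra.
pose d := (Num.truncn L).+1.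
apply: le_trans (gnp_prob_helicopter_ge _ _ ('C(n, 2) %/ d) _ L (ltW p0) (ltW p1) _);
  last exact: leq_divM.
rewrite lerD2l lerN2 -/d; apply: (@union_bound_le _ _ _ eps) => //; first exact: ltW.
- rewrite -/x; set M := expR _.
  have M1 : 1 <= M by rewrite -[leLHS]expR0 ler_expR mulr_ge0 //; lra.
  have LM : L <= M * x.
    apply: (@le_trans _ _ (x / l)).
      by rewrite ler_piMl ?divr_ge0 //; lra.
    rewrite ler_pdivrMr // mulrAC ler_peMl //; first lra.
    have <- : M * expR ((- (1 / 2) + eps) * x) = 1.
      by rewrite -expRD -[RHS]expR0; congr expR; ring.
    by rewrite ler_pM2l ?expR_gt0 //; lra.
  by rewrite /d -natr1 mulrDr mulr1 addrC; lra.
- have qe : eps <= 1 - p by lra.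
  (* Since [1 - p = expR (- l)], the real power [L] of [1 - p] is exactly [n] to the [- eps / 2];
     the extra unit in [d] costs only a factor [1 - p >= eps]. *)
  have qK : expR (- (eps / 2 * x)) <= (1 - p) ^+ Num.truncn L.
    have -> : 1 - p = expR (- l) by rewrite /l div1r lnV // opprK lnK.
    rewrite -expRM_natl ler_expR mulrN lerN2.
    have <- : L * l = eps / 2 * x by rewrite /L; field; rewrite gt_eqF.
    by rewrite ler_wpM2r // ltW.
  by rewrite /d exprS; apply: ler_pM qK => //; exact: ltW.
Qed.

Theorem theorem1p3 (R : realType) (eps : R) (heps : 0 < eps) :
  exists2 c : R, 0 < c &
  forall p : nat -> R,
    (\forall n \near \oo,
       (n%:R `^ (- (1 / 2) + eps) <= p n) /\ (p n <= 1 - eps)) ->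
    aas p (fun n => [set G : sgraph 'I_n |
      (helicopter_time R G <= acquaintance_time R G)%E /\
      ((eps / 2 * log_base (1 / (1 - p n)) n%:R)%:E <= helicopter_time R G)%E])
    /\
    aas p (fun n => [set G : sgraph 'I_n |
      ((c * (ln n%:R / p n))%:E <= helicopter_time R G)%E]).
Proof.
(* One factor [eps] comes from [eps / 2], the other from [ln (1 / (1 - p)) <= p / eps]. *)
exists (eps ^+ 2 / 2) => [|p hp]; first by rewrite divr_gt0 ?exprn_gt0.
(* The range allowed for [p n] is nonempty for some positive [n]. *)
have e1 : eps <= 1.
  have [n [/= [pn pe] n0]] := filter_ex (filterI hp (nbhs_infty_gt 0%N)).
  have : 0 < n%:R `^ (- (1 / 2) + eps) by rewrite powR_gt0 // ltr0n.
  by lra.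
have [X cube] := cube_le_expR _ _ heps e1.
have large : \forall n \near \oo, [/\ (1 < n)%N, 1 <= ln (n%:R : R) & X <= ln (n%:R : R)].
  near=> n.
  have n1 : (1 < n)%N by near: n; exact: nbhs_infty_gt.
  have n0 : 0 < n%:R :> R by rewrite ltr0n ltnW.
  split=> //.
  - rewrite -ler_expR lnK ?posrE //; near: n; exact: nbhs_infty_ger.
  - rewrite -ler_expR lnK ?posrE //; near: n; exact: nbhs_infty_ger.
(* Both conclusions follow from the same event, whose probability is squeezed between [1 - 1 / n]
   and 1. *)
have whp (A : forall n, set (sgraph 'I_n)) :
    (\forall n \near \oo, [set G : sgraph 'I_n |
       ((eps / 2 * log_base (1 / (1 - p n)) n%:R)%:E <= helicopter_time R G)%E]
     `<=` A n) -> aas p A.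
  move=> hA.
  apply: (@squeeze_cvgr _ _ _ _ (fun n => 1 - n%:R^-1) (fun=> 1)); last 2 first.
  - rewrite -[X in _ --> X]subr0; apply: cvgB; first exact: cvg_cst.
    by apply/gtr0_cvgV0; [near do rewrite ltr0n | exact: cvgr_idn].
  - exact: cvg_cst.
  near=> n.
  have [n1 x1 Xx] : [/\ (1 < n)%N, 1 <= ln (n%:R : R) & X <= ln (n%:R : R)] by near: n.
  have [pn pe] : n%:R `^ (- (1 / 2) + eps) <= p n /\ p n <= 1 - eps by near: n.
  have p0 : 0 <= p n by apply: le_trans pn; exact: powR_ge0.
  have p1 : p n <= 1 by lra.
  rewrite gnp_prob_le1 // andbT.
  apply: le_trans (gnp_prob_helicopter_log_ge _ _ _ _ n1 x1 heps (cube _ Xx) pn pe) _.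
  by apply: le_gnp_prob => //; near: n.
split; apply: whp.
  by near=> n => G /= LG; split => //; exact: helicopter_le_acquaintance.
near=> n => G /=; apply: le_trans; rewrite lee_fin.
have [n1 x1 _] : [/\ (1 < n)%N, 1 <= ln (n%:R : R) & X <= ln (n%:R : R)] by near: n.
have [pn pe] : n%:R `^ (- (1 / 2) + eps) <= p n /\ p n <= 1 - eps by near: n.
have p0 : 0 < p n by apply: lt_le_trans pn; rewrite powR_gt0 // ltr0n ltnW.
have p1 : p n < 1 by lra.
have l0 : 0 < ln (1 / (1 - p n)) by apply: lt_le_trans p0 _; exact: le_ln_inv_compl.
rewrite /log_base expr2 -!mulrA ler_pM2l // mulrCA ler_pM2l ?invr_gt0 //.
rewrite mulrCA ler_pM2l; last by lra.
rewrite -invf_div lef_pV2 ?posrE ?divr_gt0 //.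
by apply: ln_inv_compl_le; rewrite // ltW.
Unshelve. all: by end_near.
Qed.
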